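(* Let $m\ge2$ and $2\le s\le q$ be integers with $q$ a prime power, let $S_1,\dots,S_m\subseteq\mathbb{F}_q$ each have $s$ elements, and $n=s^m$. Let $\delta\in\{1,\dots,s^m\}$, let $v\in\{0,\dots,m-1\}$ with $s^v\le\delta\le s^{v+1}$, and let $\delta^\perp$ be a positive integer with $\delta^\perp\le\lfloor(s-\frac{\delta}{s^v}+1)s^{m-v-1}\rfloor$. With $L_1=\{N\in\Delta(s,\dots,s)\mid D(N)\ge\delta\}$ and $L_2=\{N\in\Delta(s,\dots,s)\mid D^\perp(N)<\delta^\perp\}$ we have $L_2\subseteq L_1$, and $\ell=\#L_1-\#L_2=\dim C(L_1)-\dim C(L_2)$ satisfies $$\ell\ \ge\ s^m-\sum_{t=1}^m\frac{1}{(t-1)!}\left(\delta\Big(\ln\frac{s^m}{\delta}\Big)^{t-1}+\delta^\perp\Big(\ln\frac{s^m}{\delta^\perp}\Big)^{t-1}\right).$$ If $\ell\ge1$ then $M_1(C(L_1),C(L_2))\ge\delta$ and $M_1(C(L_2)^\perp,C(L_1)^\perp)\ge\delta^\perp$. Equivalently, this yields a linear ramp secret sharing scheme over $\mathbb{F}_q$ with $n=s^m$ participants and secrets in $\mathbb{F}_q^\ell$ with first privacy number $t_1\ge\delta^\perp-1$ and last reconstruction number $r_\ell\le s^m-\delta+1$, and an asymmetric quantum (CSS) code with parameters $[[s^m,\ell,d_z\ge\delta/d_x\ge\delta^\perp]]_q$.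
   Context: $S=S_1\times\cdots\times S_m=\{\alpha_1,\dots,\alpha_n\}$. $\Delta(s,\dots,s)=\{X_1^{i_1}\cdots X_m^{i_m}\mid 0\le i_t<s\}$. For $L\subseteq\Delta(s,\dots,s)$, $C(L)\subseteq\mathbb{F}_q^n$ is the span of $(N(\alpha_1),\dots,N(\alpha_n))$, $N\in L$; $C^\perp$ is the Euclidean dual. For $N=X_1^{i_1}\cdots X_m^{i_m}$: $D(N)=\prod_t(s-i_t)$, $D^\perp(N)=\prod_t(i_t+1)$. For linear codes $C_2\subsetneq C_1$, $M_1(C_1,C_2)=\min\{w_H(\vec c)\mid\vec c\in C_1\setminus C_2\}$. For the ramp scheme $C_1/C_2$ with $\ell=\dim C_1-\dim C_2$ one has $t_1=M_1(C_2^\perp,C_1^\perp)-1$ and $r_\ell=n-M_1(C_1,C_2)+1$; the CSS asymmetric quantum code from $C_2\subset C_1$ has parameters $[[n,\ell,d_z/d_x]]_q$ with $d_z=M_1(C_1,C_2)$, $d_x=M_1(C_2^\perp,C_1^\perp)$. *)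

(* Defs.v *)
From Stdlib Require Import Reals Factorial.

(* ---- Real-valued parts (stated before MathComp is imported, since both
        libraries use the %R delimiter). ---- *)
Section RealPart.
Local Open Scope R_scope.

(* s^m - sum_{t=1}^m 1/(t-1)! (d (ln(s^m/d))^(t-1) + dp (ln(s^m/dp))^(t-1)),
   written with k = t-1 ranging over 0..m-1 (sum_f_R0 f (m-1) has m terms). *)
Definition ell_bound (s m d dp : nat) : R :=
  INR s ^ m -
  sum_f_R0 (fun k => / INR (fact k) *
     (INR d * (ln (INR s ^ m / INR d)) ^ k +
      INR dp * (ln (INR s ^ m / INR dp)) ^ k)) (Nat.pred m).

Definition dperp_ok (s m v d dp : nat) : Prop :=
  INR dp <= IZR (Int_part ((INR s - INR d / INR s ^ v + 1) * INR s ^ (m - v - 1)%nat)).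
End RealPart.

From HB Require Import structures.
From mathcomp Require Import all_boot all_order all_algebra.
Set Implicit Arguments. Unset Strict Implicit. Unset Printing Implicit Defensive.
Import GRing.Theory.
Local Open Scope ring_scope.

Definition wt (F : fieldType) (n : nat) (c : 'rV[F]_n) : nat :=
  #|[set j : 'I_n | c 0 j != 0]|.

Definition M1 (F : finFieldType) (n : nat) (C1 C2 : 'M[F]_n) : nat :=
  \big[minn/n]_(c : 'rV[F]_n | (c <= C1)%MS && ~~ (c <= C2)%MS) wt c.

Definition dualC (F : fieldType) (n : nat) (C : 'M[F]_n) : 'M[F]_n := kermx C^T.

(* Monomials X_1^{i_1}...X_m^{i_m} in Delta(s,...,s), as exponent vectors *)
Definition Dfun (m s : nat) (e : {ffun 'I_m -> 'I_s}) : nat :=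
  \prod_(t < m) (s - e t)%N.
Definition Dperp (m s : nat) (e : {ffun 'I_m -> 'I_s}) : nat :=
  \prod_(t < m) (e t).+1.

Definition ev (F : fieldType) (m s n : nat) (alpha : 'I_n -> {ffun 'I_m -> F})
  (e : {ffun 'I_m -> 'I_s}) : 'rV[F]_n :=
  \row_(j < n) \prod_(t < m) (alpha j t) ^+ (e t).

Definition code (F : fieldType) (m s n : nat) (alpha : 'I_n -> {ffun 'I_m -> F})
  (L : {set {ffun 'I_m -> 'I_s}}) : 'M[F]_n :=
  (\sum_(e in L) <<ev alpha e>>)%MS.

(* ramp scheme C1/C2: t_1 = M1(C2^perp, C1^perp) - 1, r_l = n - M1(C1,C2) + 1 *)
Definition t1 (F : finFieldType) (n : nat) (C1 C2 : 'M[F]_n) : nat :=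
  (M1 (dualC C2) (dualC C1)).-1.
Definition rl (F : finFieldType) (n : nat) (C1 C2 : 'M[F]_n) : nat :=
  (n - M1 C1 C2).+1.

(* Main.v *)
Require Import Defs.
From Stdlib Require Import Reals Factorial Lra Lia.

(* A nonzero polynomial supported on L has, on the grid, at least D(N) nonzeros
   for some N in its support, and a nonzero word c pairs nontrivially with some
   monomial N with D^perp(N) <= wt c; both follow by induction on the number of
   variables.  The former also shows that distinct monomials evaluate to
   independent vectors, so dimensions are cardinalities.

   L_2 is contained in L_1 because
     s^v D^perp(N) + s^(m-v-1) D(N) >= s^m + s^(m-1),
   the left-hand side being affine in each exponent and the inequality being
   elementary at the vertices of the box.

   For the bound on l, the complement of L_1 is equinumerous with
   {N | D^perp(N) < d}, so in both cases one counts lattice points of [1, s]^m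
   with product below d; they are at most the volume of {x in [0, s]^m |
   x_1 ... x_m <= d}, namely d sum_{k < m} ln(s^m/d)^k / k!. *)

(** * Truncated exponential and volume below a hyperboloid *)

Section TruncatedExponential.
Local Open Scope R_scope.

(** The Taylor polynomial of [exp] with [m] terms, indexed so that [exp_trunc m] is the derivative
    of [exp_trunc (S m)]. *)
Fixpoint exp_trunc (m : nat) (x : R) : R :=
  match m with
  | O => 0
  | S k => exp_trunc k x + / INR (fact k) * x ^ k
  end.

Lemma exp_trunc_0 (m : nat) : exp_trunc (S m) 0 = 1.
Proof.
induction m as [|m IH]; [simpl; field|].
change (exp_trunc (S m) 0 + / INR (fact (S m)) * 0 ^ S m = 1).
rewrite IH, pow_i by apply Nat.lt_0_succ; ring.
Qed.

Lemma exp_trunc_derivable (m : nat) (x : R) :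
  derivable_pt_lim (exp_trunc (S m)) x (exp_trunc m x).
Proof.
induction m as [|m IH].
  apply (derivable_pt_lim_ext (fun _ => 1)); [intro y; simpl; field|].
  apply derivable_pt_lim_const.
change (derivable_pt_lim
  (plus_fct (exp_trunc (S m))
            (mult_real_fct (/ INR (fact (S m))) (fun y => y ^ S m)))
  x (exp_trunc m x + / INR (fact m) * x ^ m)).
apply derivable_pt_lim_plus; [exact IH|].
replace (/ INR (fact m) * x ^ m)
  with (/ INR (fact (S m)) * (INR (S m) * x ^ pred (S m))).
  apply derivable_pt_lim_scal, derivable_pt_lim_pow.
rewrite fact_simpl, mult_INR; simpl pred; field.
split; [apply INR_fact_neq_0 | apply not_0_INR; discriminate].
Qed.

Lemma le_of_deriv_nonneg (f f' : R -> R) (a b : R) :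
  a <= b -> (forall x, derivable_pt_lim f x (f' x)) ->
  (forall x, a <= x <= b -> 0 <= f' x) -> f a <= f b.
Proof.
intros [ltab|<-] df f'0; [|lra].
destruct (MVT_cor2 f f' a b ltab (fun c _ => df c)) as [c [E c_ab]].
assert (0 <= f' c) by (apply f'0; lra).
nra.
Qed.

(** The derivative of [exp_trunc (S m) t * exp (- t)] telescopes to [- t ^ m / m! * exp (- t)],
    which is nonpositive for [t >= 0]. *)
Lemma exp_trunc_ratio_decr (m : nat) (x y : R) : 0 <= x <= y ->
  exp_trunc m y * exp x <= exp_trunc m x * exp y.
Proof.
destruct m as [|m]; [simpl; lra|]; intros [x0 xy].
enough (- (exp_trunc (S m) x * exp (- x)) <= - (exp_trunc (S m) y * exp (- y))) as E.
  assert (Ex := exp_pos x); assert (Ey := exp_pos y).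
  rewrite !exp_Ropp in E.
  assert (exp_trunc (S m) y / exp y <= exp_trunc (S m) x / exp x) as E' by
    (unfold Rdiv; lra).
  apply (Rmult_le_compat_r (exp x * exp y)) in E'; [|nra].
  replace (exp_trunc (S m) y * exp x)
    with (exp_trunc (S m) y / exp y * (exp x * exp y)) by (field; lra).
  replace (exp_trunc (S m) x * exp y)
    with (exp_trunc (S m) x / exp x * (exp x * exp y)) by (field; lra).
  exact E'.
apply (le_of_deriv_nonneg (fun t => - (exp_trunc (S m) t * exp (- t)))
  (fun t => - (exp_trunc m t * exp (- t)
               + exp_trunc (S m) t * (exp (- t) * (- (1)))))); [exact xy| |].
  intro t.
  apply (derivable_pt_lim_opp (fun t => exp_trunc (S m) t * exp (- t))).
  apply (derivable_pt_lim_mult (exp_trunc (S m)) (fun t => exp (- t))).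
    apply exp_trunc_derivable.
  apply (derivable_pt_lim_comp (fun t => - t) exp).
    apply (derivable_pt_lim_opp (fun t => t)), derivable_pt_lim_id.
  apply derivable_pt_lim_exp.
intros t t_xy; simpl exp_trunc.
replace (- _) with (/ INR (fact m) * t ^ m * exp (- t)) by ring.
apply Rmult_le_pos; [|left; apply exp_pos].
apply Rmult_le_pos; [|apply pow_le; lra].
left; apply Rinv_0_lt_compat, INR_fact_lt_0.
Qed.

(** In the variable [u = exp t], [exp_trunc (S m)] has slope [exp_trunc m t / exp t], which
    decreases by [exp_trunc_ratio_decr]; so a secant is at least as steep as the tangent at its
    right end. *)
Lemma exp_trunc_concave_exp (m : nat) (x y : R) : 0 <= x <= y ->
  (exp y - exp x) * exp_trunc m y <=
  (exp_trunc (S m) y - exp_trunc (S m) x) * exp y.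
Proof.
intros [x0 xy].
enough (exp_trunc (S m) x * exp y - exp x * exp_trunc m y <=
        exp_trunc (S m) y * exp y - exp y * exp_trunc m y) by nra.
apply (le_of_deriv_nonneg
  (fun t => exp_trunc (S m) t * exp y - exp t * exp_trunc m y)
  (fun t => exp_trunc m t * exp y - exp t * exp_trunc m y)); [exact xy| |].
  intro t.
  apply (derivable_pt_lim_minus (fun t => exp_trunc (S m) t * exp y)
                                (fun t => exp t * exp_trunc m y)).
    apply (derivable_pt_lim_scal_right (exp_trunc (S m))).
    apply exp_trunc_derivable.
  apply (derivable_pt_lim_scal_right exp), derivable_pt_lim_exp.
intros t t_xy.
assert (exp_trunc m y * exp t <= exp_trunc m t * exp y)
  by (apply exp_trunc_ratio_decr; lra).
nra.
Qed.

(* [d * hyp_vol m (b ^ m / d)] is the volume of the part of the cube [0, b]^m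
   on which x_1 ... x_m <= d. *)
Definition hyp_vol (m : nat) (u : R) : R :=
  if Rle_dec u 1 then u else exp_trunc m (ln u).

(** The two branches of [hyp_vol (S m)] meet at [u = 1] because [exp_trunc (S m) 0 = 1]; [hyp_vol 0]
    jumps there from 1 to 0. *)
Lemma hyp_vol_ge1 (m : nat) (u : R) : 1 <= u ->
  hyp_vol (S m) u = exp_trunc (S m) (ln u).
Proof.
intro u1; unfold hyp_vol; destruct (Rle_dec u 1) as [u1'|_]; [|reflexivity].
replace u with 1 by lra; now rewrite ln_1, exp_trunc_0.
Qed.

(* The derivative of [hyp_vol m.+1] is the decreasing function
   [hyp_vol m u / u], and the secant slope is bounded by its right endpoint. *)
Lemma hyp_vol_secant (m : nat) (x y : R) : 0 <= x <= y ->
  (y - x) * hyp_vol m y <= (hyp_vol (S m) y - hyp_vol (S m) x) * y.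
Proof.
intros [x0 xy].
destruct (Rle_dec y 1) as [y1|y1].
  unfold hyp_vol; destruct (Rle_dec y 1); [|lra]; destruct (Rle_dec x 1); nra.
assert (ln0 : forall z, 1 <= z -> 0 <= ln z).
  intros z [z1|<-]; [left; rewrite <- ln_1; apply ln_increasing; lra|].
  rewrite ln_1; lra.
assert (K : forall z, 1 <= z <= y ->
    (y - z) * exp_trunc m (ln y) <=
    (exp_trunc (S m) (ln y) - exp_trunc (S m) (ln z)) * y).
  intros z z_y.
  assert (ln z <= ln y).
    destruct (proj2 z_y) as [zy|zy]; [|rewrite zy; lra].
    left; apply ln_increasing; lra.
  assert (0 <= ln z) by (apply ln0; lra).
  assert (E := exp_trunc_concave_exp m (ln z) (ln y)).
  rewrite !exp_ln in E; lra.
rewrite (hyp_vol_ge1 m y) by lra.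
replace (hyp_vol m y) with (exp_trunc m (ln y))
  by (unfold hyp_vol; destruct (Rle_dec y 1); [lra|reflexivity]).
destruct (Rle_dec x 1) as [x1|x1]; cycle 1.
  rewrite hyp_vol_ge1 by lra; apply K; lra.
(* Now [x <= 1 < y], and the interval is cut at 1: [K1] covers [[1, y]], while on [[x, 1]] the slope
   is 1, which suffices once [exp_trunc m (ln y) <= y]. *)
assert (K1 := K 1 ltac:(lra)).
rewrite ln_1, exp_trunc_0 in K1.
replace (hyp_vol (S m) x) with x
  by (unfold hyp_vol; destruct (Rle_dec x 1); [reflexivity|lra]).
assert (exp_trunc m (ln y) <= y).
  destruct m as [|m]; [simpl; lra|].
  assert (E := exp_trunc_ratio_decr (S m) 0 (ln y)).
  rewrite exp_trunc_0, exp_0, exp_ln in E by lra.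
  assert (0 <= ln y) by (apply ln0; lra).
  lra.
nra.
Qed.

Lemma exp_trunc_sum (m : nat) (x : R) :
  exp_trunc (S m) x = sum_f_R0 (fun k => / INR (fact k) * x ^ k) m.
Proof. induction m as [|m IH]; simpl in *; [ring|rewrite IH; ring]. Qed.

Lemma ell_bound_exp_trunc (s m d dp : nat) : (0 < m)%nat ->
  ell_bound s m d dp =
  INR s ^ m - INR d * exp_trunc m (ln (INR s ^ m / INR d))
            - INR dp * exp_trunc m (ln (INR s ^ m / INR dp)).
Proof.
destruct m as [|m]; [now intro H; inversion H|intros _].
unfold ell_bound; rewrite !exp_trunc_sum, !scal_sum; simpl Nat.pred.
set (x := ln _); set (y := ln _).
rewrite (sum_eq _ (fun k => / INR (fact k) * x ^ k * INR d
                          + / INR (fact k) * y ^ k * INR dp)).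
  rewrite plus_sum; ring.
intros; ring.
Qed.

(** The floor is at most its argument, and multiplication by [s ^ v] clears the denominator, leaving
    an inequality between natural numbers. *)
Lemma dperp_ok_le (s m v d dp : nat) : (0 < s)%nat -> (v < m)%nat ->
  dperp_ok s m v d dp ->
  INR dp * INR s ^ v + INR d * INR s ^ (m - v - 1)
  <= INR s ^ m + INR s ^ (m - 1).
Proof.
intros s0 vm E; unfold dperp_ok in E.
apply lt_INR in s0; simpl in s0.
set (k := (m - v - 1)%nat) in *.
replace m with (S (v + k)) by (unfold k; rewrite <- Nat.sub_add_distr; lia).
replace (S (v + k) - 1)%nat with (v + k)%nat by (simpl; now rewrite Nat.sub_0_r).
assert (vp : 0 < INR s ^ v) by now apply pow_lt.
destruct (base_Int_part ((INR s - INR d / INR s ^ v + 1) * INR s ^ k)) as [E' _].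
apply (Rle_trans _ _ _ E), (Rmult_le_compat_r (INR s ^ v)) in E'; [|lra].
simpl pow; rewrite pow_add.
replace (_ * _ * INR s ^ v)
  with (INR s * (INR s ^ v * INR s ^ k) + INR s ^ v * INR s ^ k - INR d * INR s ^ k)
  in E' by (field; lra).
lra.
Qed.
End TruncatedExponential.

From HB Require Import structures.
From mathcomp Require Import all_boot all_order all_algebra zify.
Set Implicit Arguments. Unset Strict Implicit. Unset Printing Implicit Defensive.

(** * Exponent vectors *)

Section FiniteFunctionsCons.
Variable T : Type.

Definition fcons (m : nat) (a : T) (y : {ffun 'I_m -> T}) : {ffun 'I_m.+1 -> T} :=
  [ffun t => if unlift ord0 t is Some j then y j else a].

Lemma fcons0 m a (y : {ffun 'I_m -> T}) : fcons a y ord0 = a.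
Proof. by rewrite ffunE unlift_none. Qed.

Lemma fconsS m a (y : {ffun 'I_m -> T}) j : fcons a y (lift ord0 j) = y j.
Proof. by rewrite ffunE liftK. Qed.

Lemma fcons_bij m : bijective (fun p : T * {ffun 'I_m -> T} => fcons p.1 p.2).
Proof.
exists (fun x : {ffun 'I_m.+1 -> T} => (x ord0, [ffun j => x (lift ord0 j)])).
  move=> [a y] /=; rewrite fcons0; congr pair.
  by apply/ffunP => j; rewrite ffunE fconsS.
move=> x /=; apply/ffunP => t; rewrite ffunE.
by case: unliftP => [j ->|->] //; rewrite ffunE.
Qed.

Lemma fcons_eta m (x : {ffun 'I_m.+1 -> T}) :
  x = fcons (x ord0) [ffun j => x (lift ord0 j)].
Proof.
apply/ffunP => t; rewrite ffunE.
by case: unliftP => [j ->|->] //; rewrite ffunE.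
Qed.
End FiniteFunctionsCons.

Lemma big_fcons (R : Type) (idx : R) (op : Monoid.com_law idx) (T : finType)
    (m : nat) (G : {ffun 'I_m.+1 -> T} -> R) :
  \big[op/idx]_x G x = \big[op/idx]_a \big[op/idx]_y G (fcons a y).
Proof.
rewrite (reindex (fun p : T * {ffun 'I_m -> T} => fcons p.1 p.2)) /=; last first.
  exact/onW_bij/fcons_bij.
by rewrite pair_big.
Qed.

Lemma card_set_sum (T : finType) (P : pred T) : #|[set x | P x]| = \sum_x P x.
Proof. by rewrite -sum1_card big_mkcond; apply: eq_bigr => x _; rewrite inE; case: (P x). Qed.

Lemma card_fcons (T : finType) (m : nat) (P : pred {ffun 'I_m.+1 -> T}) :
  #|[set x | P x]| = \sum_a #|[set y | P (fcons a y)]|.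
Proof. by rewrite card_set_sum big_fcons; apply: eq_bigr => a _; rewrite card_set_sum. Qed.

Lemma card_fcons_exchange (T : finType) (m : nat) (P : pred {ffun 'I_m.+1 -> T}) :
  #|[set x | P x]| = \sum_y #|[set a | P (fcons a y)]|.
Proof.
rewrite card_set_sum big_fcons exchange_big.
by apply: eq_bigr => a _; rewrite card_set_sum.
Qed.

Lemma family_fcons (T : finType) (m : nat) (S : 'I_m.+1 -> {set T}) a
    (y : {ffun 'I_m -> T}) :
  (fcons a y \in family S) =
  (a \in S ord0) && (y \in family (fun t => S (lift ord0 t))).
Proof.
apply/familyP/andP => [yS|[aS /familyP yS] t].
  split; first by rewrite -(fcons0 a y) yS.
  by apply/familyP => j; rewrite -(fconsS a y j) yS.
by case: (unliftP ord0 t) => [j ->|->]; rewrite ?fconsS ?fcons0.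
Qed.

Lemma Dfun_fcons m s (i : 'I_s) (e : {ffun 'I_m -> 'I_s}) :
  Dfun (fcons i e) = (s - i) * Dfun e.
Proof.
rewrite /Dfun big_ord_recl fcons0; congr muln.
by apply: eq_bigr => t _; rewrite fconsS.
Qed.

Lemma Dperp_fcons m s (i : 'I_s) (e : {ffun 'I_m -> 'I_s}) :
  Dperp (fcons i e) = i.+1 * Dperp e.
Proof.
rewrite /Dperp big_ord_recl fcons0; congr muln.
by apply: eq_bigr => t _; rewrite fconsS.
Qed.

Lemma Dfun_gt0 m s (e : {ffun 'I_m -> 'I_s}) : 0 < Dfun e.
Proof. by rewrite /Dfun prodn_gt0 // => t; rewrite subn_gt0. Qed.

(** The reflection [i -> s - 1 - i] of each exponent exchanges the factors [s - i] and [i + 1]. *)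
Lemma card_Dfun_lt m s d :
  #|[set e : {ffun 'I_m -> 'I_s} | Dfun e < d]| =
  #|[set e : {ffun 'I_m -> 'I_s} | Dperp e < d]|.
Proof.
pose f (e : {ffun 'I_m -> 'I_s}) := [ffun t => rev_ord (e t)].
have fK : involutive f by move=> e; apply/ffunP => t; rewrite !ffunE rev_ordK.
rewrite -(card_preimset _ (inv_inj fK)); apply: eq_card => e; rewrite !inE.
congr (_ < d); apply: eq_bigr => t _.
by rewrite !ffunE /= subKn.
Qed.

(* A function affine in each variable on [1, s]^m attains its minimum at a
   vertex; here at a vertex with [k] coordinates equal to [s]. *)
Lemma multiaffine_min m s (e : {ffun 'I_m -> 'I_s}) (A B C : nat) :
  1 < s -> (forall k, k <= m -> C <= A * s ^ (m - k) + B * s ^ k) ->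
  C <= A * Dperp e + B * Dfun e.
Proof.
move=> s1; elim: m e A B => [|m IH] e A B le_C.
  by rewrite /Dperp /Dfun !big_ord0; have := le_C 0 isT.
rewrite (fcons_eta e) Dperp_fcons Dfun_fcons.
set i := e ord0; set e' := [ffun _ => _].
have H1 : C <= A * Dperp e' + (B * s) * Dfun e'.
  apply: IH => k km; have := le_C k.+1; rewrite ltnS km subSS expnS => /(_ isT).
  by rewrite mulnA.
have H2 : C <= (A * s) * Dperp e' + B * Dfun e'.
  apply: IH => k km; have := le_C k; rewrite (leqW km) subSn // expnS => /(_ isT).
  by rewrite mulnA.
have [k sE] : exists k, s = (i + k).+1 by exists (s - i).-1; have := ltn_ord i; lia.
have iE : s - i = k.+1 by lia.
(* [H1] and [H2] are the bounds with the first exponent at its ends 0 and [s - 1]. Scaling by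
   [s - 1 = i + k] makes the value at [i] their combination with weights [k] and [i]. *)
rewrite iE -(@leq_pmul2l s.-1); last by lia.
move: (nat_of_ord i) (Dperp e') (Dfun e') sE H1 H2 {iE} => j p q.
move=> -> /= H1 H2; apply: (@leq_trans (k * C + j * C)); nia.
Qed.

(** * Counting exponent vectors *)

(** Convexity of [x -> s ^ x] makes the most balanced split least. For [q <= p] and [j = m - q], the
    gap is [s ^ q * (s ^ j.+1 - 1) * (s ^ j - 1)]. *)
Lemma expn_add_ge s m p q : 0 < s -> p + q = m.+1 + m ->
  s ^ m.+1 + s ^ m <= s ^ p + s ^ q.
Proof.
move=> s0.
wlog le_qp : p q / q <= p.
  move=> H; case: (leqP q p) => [/H//|/ltnW le_pq pq].
  by rewrite (addnC (s ^ p)); apply: H => //; rewrite addnC.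
move=> pq; have [j [-> ->]] : exists j, p = q + (j + j).+1 /\ m = q + j.
  by exists (m - q); lia.
rewrite -addnS !expnD -!mulnDr -[X in _ <= _ + X]muln1 -mulnDr leq_mul2l; apply/orP; right.
rewrite !expnS expnD.
have: 0 < s ^ j by rewrite expn_gt0 s0.
move: (s ^ j) => x x0; nia.
Qed.

(** At every vertex the two terms are powers of [s] whose exponents add up to [2m - 1], the
    situation of [expn_add_ge]. *)
Lemma Dperp_Dfun_ge m s v (e : {ffun 'I_m -> 'I_s}) : 1 < s -> v < m ->
  s ^ m + s ^ m.-1 <= s ^ v * Dperp e + s ^ (m - v - 1) * Dfun e.
Proof.
move=> s1 vm; apply: multiaffine_min => // k km.
case: m vm e km => // m vm e km.
by rewrite -!expnD; apply: expn_add_ge; lia.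
Qed.

Lemma INR_expn s k : INR (s ^ k) = pow (INR s) k.
Proof.
elim: k => [|k IH]; first by rewrite expn0.
by rewrite expnS (mult_INR s) IH.
Qed.

Lemma dperp_ok_leq s m v d dp : 1 < s -> v < m -> dperp_ok s m v d dp ->
  dp * s ^ v + d * s ^ (m - v - 1) <= s ^ m + s ^ m.-1.
Proof.
move=> s1 vm /dperp_ok_le E.
apply/leP/INR_le; rewrite !plus_INR !mult_INR !INR_expn.
rewrite -subn1; apply: E; apply/ltP => //; exact: ltnW.
Qed.

(** This keeps [ln (s ^ m / dp)] nonnegative and [dp] within the code length. *)
Lemma dperp_ok_leq_card s m v d dp : 1 < s -> v < m -> s ^ v <= d ->
  dperp_ok s m v d dp -> dp <= s ^ m.
Proof.
move=> s1 vm le_d /(dperp_ok_leq s1 vm) E.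
have H : s ^ m.-1 <= d * s ^ (m - v - 1).
  have -> : m.-1 = v + (m - v - 1) by lia.
  by rewrite expnD leq_mul2r le_d orbT.
have : 0 < s ^ v by rewrite expn_gt0 ltnW.
move: (s ^ v) (s ^ m) (s ^ m.-1) (d * _) E H => *; nia.
Qed.

(** The factor [c] accumulates the coordinates already fixed: the slice of first coordinate [a + 1]
    is the same count in one variable fewer, with [c * (a + 1)]. *)
Lemma card_Dperp_le_hyp_vol m s c d : 0 < s -> 0 < c -> 0 < d ->
  Rle (INR #|[set e : {ffun 'I_m -> 'I_s} | c * Dperp e <= d]|)
      (Rmult (Rdiv (INR d) (INR c))
         (hyp_vol m (Rdiv (pow (INR s) m) (Rdiv (INR d) (INR c))))).
Proof.
move=> s0 + d0; have d0' : Rlt 0 (INR d) by apply: (lt_INR 0); apply/ltP.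
elim: m c => [|m IH] c c0; have c0' : Rlt 0 (INR c) by apply: (lt_INR 0); apply/ltP.
(* Without variables the count is 1 or 0 according as [c <= d] or not; the jump of [hyp_vol 0] past
   1 matches this. *)
- have -> : [set e : {ffun 'I_0 -> 'I_s} | c * Dperp e <= d]
          = [set e | c <= d] by apply/setP => e; rewrite !inE /Dperp big_ord0 muln1.
  have -> : #|[set e : {ffun 'I_0 -> 'I_s} | c <= d]| = (c <= d).
    by rewrite card_set_sum sum_nat_const card_ffun !card_ord expn0 mul1n.
  have -> : (Rdiv (pow (INR s) 0) (Rdiv (INR d) (INR c)) = Rdiv (INR c) (INR d))%type.
    by rewrite /=; field; lra.
  rewrite /hyp_vol; case: leqP => [/leP/le_INR cd|/ltP/lt_INR cd] /=.
    case: Rle_dec => [_|[]]; first by right; field; lra.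
    by apply: (Rmult_le_reg_r (INR d)) => //; field_simplify; lra.
  have ratio_pos : Rlt 0 (Rdiv (INR d) (INR c)) by apply: Rdiv_lt_0_compat.
  case: Rle_dec => [le1|_]; last by rewrite Rmult_0_r; right.
  by apply: Rmult_le_pos; [left | left; apply: Rdiv_lt_0_compat].
set r := Rdiv (INR d) (INR c).
have r0 : Rlt 0 r by apply: Rdiv_lt_0_compat.
rewrite card_fcons.
pose f (a : nat) := #|[set y : {ffun 'I_m -> 'I_s} | (c * a.+1) * Dperp y <= d]|.
have -> : \sum_(a < s) #|[set y : {ffun 'I_m -> 'I_s} | c * Dperp (fcons a y) <= d]|
        = \sum_(a < s) f a.
  apply: eq_bigr => a _; apply: eq_card => y.
  by rewrite !inE Dperp_fcons mulnA.
(* By [hyp_vol_secant] the slice of first coordinate a + 1 is at most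
   [r * (hyp_vol m.+1 (u a.+1) - hyp_vol m.+1 (u a))], and these telescope. *)
pose u k := Rdiv (Rmult (INR k) (pow (INR s) m)) r.
have sm_gt0 : Rlt 0 (pow (INR s) m) by apply/pow_lt/(lt_INR 0); apply/ltP.
have sm0 := Rlt_le _ _ sm_gt0.
(* [r * hyp_vol m.+1 (u k)] is the volume below the hyperboloid over the box [[0, k] x [0, s]^m];
   the goal is the case [k = s]. *)
have H k : Rle (INR (\sum_(a < k) f a)) (Rmult r (hyp_vol m.+1 (u k))).
  elim: k => [|k IHk].
    rewrite big_ord0 /u /= Rmult_0_l /Rdiv Rmult_0_l /hyp_vol.
    by case: Rle_dec => [_|[]]; lra.
  rewrite big_ord_recr /= plus_INR.
  have k0 : Rle 0 (INR k) by apply: pos_INR.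
  have k1 : (INR k.+1 = Rplus (INR k) 1)%type by rewrite S_INR.
  have uk : Rle 0 (u k) /\ Rle (u k) (u k.+1).
    split; first by apply: Rmult_le_pos; [apply: Rmult_le_pos|left; apply: Rinv_0_lt_compat].
    apply: Rmult_le_compat_r; first by left; apply: Rinv_0_lt_compat.
    by apply: Rmult_le_compat_r => //; lra.
  have S := hyp_vol_secant m (u k) (u k.+1) uk.
  have ck : 0 < c * k.+1 by rewrite muln_gt0 c0.
  have {}IH := IH _ ck.
  rewrite mult_INR in IH.
  have E1 : (Rdiv (INR d) (Rmult (INR c) (INR k.+1)) = Rdiv r (INR k.+1))%type.
    by rewrite /r; field; lra.
  have E2 : (Rdiv (pow (INR s) m) (Rdiv r (INR k.+1)) = u k.+1)%type.
    by rewrite /u; field; lra.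
  rewrite -/(f k) E1 E2 in IH.
  set w := Rdiv (pow (INR s) m) r.
  have w0 : Rlt 0 w by apply: Rdiv_lt_0_compat.
  have uE i : (u i = Rmult (INR i) w)%type by rewrite /u /w /Rdiv Rmult_assoc.
  move: S IHk IH; rewrite !uE k1.
  set h := hyp_vol m _; set h2 := hyp_vol _ _; set h1 := hyp_vol _ _ => S IHk IH.
  have {}S : Rle h (Rmult (Rminus h2 h1) (Rplus (INR k) 1)).
    by apply: (Rmult_le_reg_l w) => //; lra.
  have rk : Rlt 0 (Rdiv r (Rplus (INR k) 1)) by apply: Rdiv_lt_0_compat; lra.
  have := Rmult_le_compat_l _ _ _ (Rlt_le _ _ rk) S.
  have -> : (Rmult (Rdiv r (Rplus (INR k) 1)) (Rmult (Rminus h2 h1) (Rplus (INR k) 1))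
     = Rmult r (Rminus h2 h1))%type by field; lra.
  by move=> rS; apply: Rle_trans (Rplus_le_compat _ _ _ _ IHk IH) _; lra.
exact: H.
Qed.

Lemma card_Dperp_lt_exp_trunc m s d : 0 < m -> 0 < s -> 0 < d -> d <= s ^ m ->
  Rle (INR #|[set e : {ffun 'I_m -> 'I_s} | Dperp e < d]|)
      (Rmult (INR d) (exp_trunc m (ln (Rdiv (pow (INR s) m) (INR d))))).
Proof.
case: m => // m _ s0 d0 le_d.
have d0' : Rlt 0 (INR d) by apply: (lt_INR 0); apply/ltP.
apply: (Rle_trans _ (INR #|[set e : {ffun 'I_m.+1 -> 'I_s} | 1 * Dperp e <= d]|)).
  apply/le_INR/leP/subset_leq_card/subsetP => e.
  by rewrite !inE mul1n => /ltnW.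
apply: Rle_trans (card_Dperp_le_hyp_vol _ s0 _ d0) _ => //.
rewrite [INR 1]/= Rdiv_1_r hyp_vol_ge1; first by right.
apply: (Rmult_le_reg_r (INR d)) => //.
rewrite /Rdiv Rmult_assoc Rinv_l; last by lra.
rewrite -INR_expn; have := le_INR _ _ (elimT leP le_d); lra.
Qed.

(** * Footprint bounds *)

Section GridCodes.
Import GRing.Theory.
Local Open Scope ring_scope.

Definition monomial_at (F : fieldType) (m s : nat) (x : {ffun 'I_m -> F})
  (e : {ffun 'I_m -> 'I_s}) : F := \prod_(t < m) x t ^+ e t.

Lemma monomial_at_fcons (F : fieldType) (m s : nat) a (x : {ffun 'I_m -> F})
    (i : 'I_s) e :
  monomial_at (fcons a x) (fcons i e) = a ^+ i * monomial_at x e.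
Proof.
rewrite /monomial_at big_ord_recl !fcons0; congr (_ * _).
by apply: eq_bigr => t _; rewrite !fconsS.
Qed.

Lemma card_nonroots_ge (F : finFieldType) (A : {set F}) s (b : 'I_s -> F) (i : 'I_s) :
  b i != 0 -> (forall j : 'I_s, (i < j)%N -> b j = 0) ->
  (#|A| - i <= #|[set x in A | (\sum_j b j * x ^+ j != 0)%R]|)%N.
Proof.
move=> bi b0; pose p : {poly F} := \sum_(j < s) b j *: 'X^j.
have pE x : p.[x] = \sum_j b j * x ^+ j.
  by rewrite horner_sum; apply: eq_bigr => j _; rewrite hornerZ hornerXn.
have p_neq0 : p != 0.
  apply: contraNneq bi => p0; have := coef0 F i; rewrite -p0 coef_sum (bigD1 i) //=.
  rewrite coefZ coefXn eqxx mulr1 big1 ?addr0 => [->//|j ne_ji].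
  by rewrite coefZ coefXn eq_sym (inj_eq val_inj) (negPf ne_ji) mulr0.
have size_p : (size p <= i.+1)%N.
  apply: (leq_trans (size_sum _ _ _)); apply/bigmax_leqP => j _.
  case: (leqP j i) => [ji|/b0 ->]; last by rewrite scale0r size_poly0.
  by apply: leq_trans (size_scale_leq _ _) _; rewrite size_polyXn.
have roots : (#|[set x in A | root p x]| <= i)%N.
  rewrite -ltnS; apply: leq_trans size_p; rewrite cardE.
  apply: max_poly_roots => //; last exact: enum_uniq.
  by apply/allP => x; rewrite mem_enum inE => /andP[].
rewrite leq_subLR; apply: leq_trans (leq_add roots (leqnn _)).
rewrite -cardsUI; apply: leq_trans (leq_addr _ _); apply/subset_leq_card/subsetP => x xA.
by rewrite !inE xA /= -pE rootE; case: (p.[x] == 0).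
Qed.

(* Induct on the number of variables, taking in the first variable the largest
   degree whose coefficient polynomial is nonzero. *)
Lemma footprint_bound (F : finFieldType) (m s : nat) (S : 'I_m -> {set F})
    (c : {ffun 'I_m -> 'I_s} -> F) e0 :
  (forall t, #|S t| = s) -> c e0 != 0 ->
  exists2 e, c e != 0 &
    (Dfun e <= #|[set x in family S | (\sum_e c e * monomial_at x e != 0)%R]|)%N.
Proof.
elim: m S c e0 => [|m IH] S c e0 cardS c0.
  exists e0 => //; rewrite /Dfun big_ord0 card_gt0; apply/set0Pn.
  have all_eq T (x y : {ffun 'I_0 -> T}) : x = y by apply/ffunP => -[].
  exists [ffun=> 0]; rewrite inE; apply/andP; split; first by apply/familyP => -[].
  rewrite (big_pred1 e0) => [|e]; first by rewrite /monomial_at big_ord0 mulr1.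
  by rewrite (all_eq _ e e0) /= eqxx.
pose P (i : 'I_s) := [exists e, c (fcons i e) != 0].
have P0 : P (e0 ord0) by by apply/existsP; exists [ffun j => e0 (lift ord0 j)]; rewrite -fcons_eta.
case: (@arg_maxnP _ _ P (fun i => i : nat) P0) => i /existsP[e1 ce1] i_max.
have [e ce De] := IH (fun t => S (lift ord0 t)) (fun e => c (fcons i e)) e1
  (fun t => cardS _) ce1.
exists (fcons i e) => //; rewrite Dfun_fcons.
set A := [set x in _ | _] in De.
have sumE a x : \sum_e c e * monomial_at (fcons a x) e
    = \sum_j (\sum_e c (fcons j e) * monomial_at x e) * a ^+ j.
  rewrite big_fcons; apply: eq_bigr => j _; rewrite mulr_suml.
  by apply: eq_bigr => e' _; rewrite monomial_at_fcons mulrA mulrAC.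
rewrite card_fcons_exchange.
apply: (@leq_trans (\sum_(x in A) (s - i))%N).
  by rewrite sum_nat_const mulnC leq_mul2r De orbT.
rewrite big_mkcond; apply: leq_sum => x _; case: ifP => //.
rewrite in_set => /andP[xS fx].
(* On the line over [x] the polynomial has degree exactly [i]: that coefficient is nonzero because
   [x] lies in [A], and maximality of [i] kills the higher ones. *)
pose b j := \sum_e c (fcons j e) * monomial_at x e.
have := @card_nonroots_ge _ (S ord0) s b i fx; rewrite cardS => H.
apply: leq_trans (H _) _ => [j ij|].
  apply: big1 => e' _; case: (eqVneq (c (fcons j e')) 0) => [->|cj]; first by rewrite mul0r.
  by have /= := i_max j (introT existsP (ex_intro _ e' cj)); rewrite leqNgt ij.
by apply/subset_leq_card/subsetP => a; rewrite !in_set family_fcons xS andbT sumE.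
Qed.

(** Pair [g] with the monic polynomial whose roots are the support of [g] in [A] without [a]: only
    the term at [a] survives, and the degree is one less than the size of the support. *)
Lemma moment_lt_card (F : finFieldType) (A : {set F}) (g : F -> F) a :
  a \in A -> g a != 0 ->
  exists2 j, (j < #|[set x in A | (g x != 0)%R]|)%N & \sum_(x in A) g x * x ^+ j != 0.
Proof.
move=> aA ga; set B := [set x in A | _].
have aB : a \in B by rewrite inE aA.
pose p : {poly F} := \prod_(b <- enum (B :\ a)) ('X - b%:P).
have size_p : size p = #|B| by rewrite size_prod_XsubC -cardE (cardsD1 a B) aB.
have pa : p.[a] != 0.
  by rewrite -[_ == _]/(root p a) root_prod_XsubC mem_enum !inE eqxx.
have E : \sum_(x in A) g x * p.[x] = g a * p.[a].
  rewrite (bigD1 a) //= big1 ?addr0 // => x /andP[xA ne_xa].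
  case: (eqVneq (g x) 0) => [->|gx]; first by rewrite mul0r.
  suff -> : p.[x] = 0 by rewrite mulr0.
  apply/rootP; rewrite root_prod_XsubC mem_enum.
  by rewrite !inE ne_xa xA.
have : \sum_(x in A) g x * p.[x] != 0 by rewrite E mulf_neq0.
have -> : \sum_(x in A) g x * p.[x]
        = \sum_(j < #|B|) p`_j * \sum_(x in A) g x * x ^+ j.
  under [RHS]eq_bigr => j _ do rewrite mulr_sumr.
  rewrite exchange_big; apply: eq_bigr => x _ /=.
  by rewrite horner_coef size_p mulr_sumr; apply: eq_bigr => j _; rewrite mulrCA.
case: (boolP [exists j : 'I_#|B|, \sum_(x in A) g x * x ^+ j != 0]).
  by case/existsP => j ? _; exists j.
rewrite negb_exists => /forallP H; rewrite big1 ?eqxx // => j _.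
by have := H j; rewrite negbK => /eqP ->; rewrite mulr0.
Qed.

(* Dual to [footprint_bound]: take in the first variable the smallest degree [i]
   whose moment is nonzero; on each fibre where this moment does not vanish, the
   vanishing of the moments below [i] forces at least [i + 1] nonzero values. *)
Lemma dual_footprint_bound (F : finFieldType) (m s : nat) (S : 'I_m -> {set F})
    (c : {ffun 'I_m -> F} -> F) x0 :
  (forall t, #|S t| = s) -> x0 \in family S -> c x0 != 0 ->
  exists2 e : {ffun 'I_m -> 'I_s},
    \sum_(x in family S) c x * monomial_at x e != 0 &
    (Dperp e <= #|[set x in family S | c x != 0%R]|)%N.
Proof.
elim: m S c x0 => [|m IH] S c x0 cardS x0S c0.
  have all_eq T (x y : {ffun 'I_0 -> T}) : x = y by apply/ffunP => -[].
  (* ['I_s] may be empty here, so the exponent vector is obtained from the absurdity of an index in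
     ['I_0]. *)
  exists [ffun i : 'I_0 => False_rect 'I_s (notF (ltn_ord i))].
    rewrite (big_pred1 x0) => [|x]; first by rewrite /monomial_at big_ord0 mulr1.
    by rewrite (all_eq _ x x0) /= eqxx x0S.
  rewrite /Dperp big_ord0 card_gt0; apply/set0Pn; exists x0.
  by rewrite inE x0S.
pose S' t := S (lift ord0 t).
pose mom j y := \sum_(a in S ord0) c (fcons a y) * a ^+ j.
have sumE j (e : {ffun 'I_m -> 'I_s}) :
    \sum_(x in family S) c x * monomial_at x (fcons j e)
    = \sum_(y in family S') mom j y * monomial_at y e.
  rewrite big_mkcond big_fcons exchange_big /= [RHS]big_mkcond.
  apply: eq_bigr => y _; case: ifP => yS.
    rewrite /mom mulr_suml [RHS]big_mkcond; apply: eq_bigr => a _.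
    by rewrite family_fcons yS andbT monomial_at_fcons mulrA.
  by rewrite big1 // => a _; rewrite family_fcons yS andbF.
pose P j := [exists y in family S', mom j y != 0].
have x0E := fcons_eta x0.
(* A nonzero moment of degree below [s] on the line through [x0] ensures that the least degree [i]
   is a legal exponent. *)
have [j0 j0_lt Pj0] : exists2 j, (j < s)%N & P j.
  move: x0S c0; rewrite x0E family_fcons => /andP[aS yS] ca.
  have [j jlt momj] := moment_lt_card (g := fun a => c (fcons a _)) aS ca.
  exists j; last by apply/existsP; eexists; apply/andP; split; [exact: yS|exact: momj].
  apply: leq_trans jlt _; rewrite -(cardS ord0); apply/subset_leq_card/subsetP => a.
  by rewrite inE => /andP[].
have exP : exists j, P j by exists j0.
case: (ex_minnP exP) => i /existsP[y0 /andP[y0S mom0]] i_min.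
have i_lt : (i < s)%N by apply: leq_ltn_trans (i_min _ Pj0) j0_lt.
have [e mome De] := IH S' (mom i) y0 (fun t => cardS _) y0S mom0.
exists (fcons (Ordinal i_lt) e); rewrite ?sumE // Dperp_fcons /=.
set A := [set y in _ | _] in De.
rewrite card_fcons_exchange.
apply: (@leq_trans (\sum_(x in A) i.+1)%N).
  by rewrite sum_nat_const mulnC leq_mul2r De orbT.
rewrite big_mkcond; apply: leq_sum => y _; case: ifP => //.
rewrite in_set => /andP[yS momy].
have [a aS ca] : exists2 a, a \in S ord0 & c (fcons a y) != 0.
  apply/exists_inP; apply: contraNT momy; rewrite negb_exists_in => /forall_inP H.
  rewrite /mom big1 // => a /H; rewrite negbK => /eqP ->; exact: mul0r.
have [j jlt momj] := moment_lt_card (g := fun a => c (fcons a y)) aS ca.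
have ij : (i <= j)%N by apply: i_min; apply/existsP; exists y; rewrite yS.
apply: leq_ltn_trans ij (leq_trans jlt _).
by apply/subset_leq_card/subsetP => b; rewrite !in_set family_fcons yS andbT.
Qed.

(** * Evaluation codes on the grid: dimension, weights and dual weights *)

Section Codes.
Variables (F : finFieldType) (m s n : nat) (S : 'I_m -> {set F}).
Variable (alpha : 'I_n -> {ffun 'I_m -> F}).
Hypotheses (cardS : forall t, #|S t| = s) (card_n : n = (s ^ m)%N).
Hypotheses (alpha_inj : injective alpha) (alphaS : forall j t, alpha j t \in S t).

Lemma imset_grid : [set alpha j | j : 'I_n] = [set x in family S].
Proof.
apply/eqP; rewrite eqEcard; apply/andP; split.
  by apply/subsetP => _ /imsetP[j _ ->]; rewrite in_set; apply/familyP.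
rewrite (card_imset _ alpha_inj) card_ord cardsE card_family foldrE big_map.
by rewrite (eq_bigr (fun=> s)) // big_enum prod_nat_const card_ord card_n.
Qed.

Lemma big_grid (R : Type) (idx : R) (op : Monoid.com_law idx) G :
  \big[op/idx]_j G (alpha j) = \big[op/idx]_(x in family S) G x.
Proof.
have -> : \big[op/idx]_(x in family S) G x
        = \big[op/idx]_(x in [set alpha j | j : 'I_n]) G x.
  by rewrite imset_grid; apply: eq_bigl => x; rewrite in_set.
by rewrite big_imset /= => [|i j _ _ /alpha_inj].
Qed.

Lemma wt_grid (c : 'rV[F]_n) (f : {ffun 'I_m -> F} -> F) :
  (forall j, c 0 j = f (alpha j)) ->
  wt c = #|[set x in family S | (f x != 0)%R]|.
Proof.
move=> cE; rewrite /wt !card_set_sum.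
rewrite (eq_bigr (fun j => nat_of_bool (f (alpha j) != 0))) => [|j _]; last by rewrite cE.
rewrite (big_grid _ (fun x => nat_of_bool (f x != 0))) big_mkcond /=.
by apply: eq_bigr => x _; case: (_ \in _).
Qed.

Lemma evE (e : {ffun 'I_m -> 'I_s}) j : ev alpha e 0 j = monomial_at (alpha j) e.
Proof. by rewrite mxE. Qed.

Lemma wt_comb_ev (a : {ffun 'I_m -> 'I_s} -> F) e0 : a e0 != 0 ->
  exists2 e, a e != 0 & (Dfun e <= wt (\sum_e a e *: ev alpha e))%N.
Proof.
move=> a0; have [e ae De] := footprint_bound cardS a0; exists e => //.
rewrite (@wt_grid _ (fun x => \sum_e a e * monomial_at x e)) // => j.
by rewrite summxE; apply: eq_bigr => e' _; rewrite mxE evE.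
Qed.

(** A nonzero coefficient would force the weight to be at least some [Dfun e' > 0], whereas the zero
    word has weight 0. *)
Lemma ev_independent (a : {ffun 'I_m -> 'I_s} -> F) :
  \sum_e a e *: ev alpha e = 0 -> forall e, a e = 0.
Proof.
move=> a0 e; apply/eqP; apply: contraTT isT => /wt_comb_ev[e' _].
rewrite a0 leqNgt (leq_ltn_trans _ (Dfun_gt0 e')) // leqn0 cards_eq0.
by apply/eqP/setP => j; rewrite !inE mxE eqxx.
Qed.

Lemma sub_codeP (L : {set {ffun 'I_m -> 'I_s}}) (c : 'rV[F]_n) :
  (c <= code alpha L)%MS ->
  exists2 a, c = \sum_e a e *: ev alpha e & forall e, e \notin L -> a e = 0.
Proof.
case/sub_sumsmxP => u ->.
have H e : exists k, u e *m <<ev alpha e>>%MS == k *: ev alpha e.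
  have /sub_rVP[k ->] : (u e *m <<ev alpha e>> <= ev alpha e)%MS.
    by apply: submx_trans (submxMl _ _) _; rewrite genmxE.
  by exists k.
exists (fun e => if e \in L then xchoose (H e) else 0) => [|e /negPf -> //].
rewrite big_mkcond; apply: eq_bigr => e _; case: ifP => _; last by rewrite scale0r.
exact/eqP/(xchooseP (H e)).
Qed.

Lemma ev_sub_code (L : {set {ffun 'I_m -> 'I_s}}) e :
  e \in L -> (ev alpha e <= code alpha L)%MS.
Proof. by move=> eL; rewrite (sumsmx_sup e) ?genmxE. Qed.

Lemma rank_code (L : {set {ffun 'I_m -> 'I_s}}) : \rank (code alpha L) = #|L|.
Proof.
have ev_neq0 (e : {ffun 'I_m -> 'I_s}) : ev alpha e != 0.
  apply/eqP => e0; have := @ev_independent (fun e' => (e' == e)%:R) _ e.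
  rewrite eqxx (bigD1 e) //= e0 scaler0 add0r big1 => [|e' /negPf ->].
    by move=> /(_ erefl)/eqP; rewrite oner_eq0.
  exact: scale0r.
have dx : mxdirect (\sum_(e in L) <<ev alpha e>>)%MS.
  apply/mxdirect_sumsP => e eL; apply/eqP; rewrite -submx0.
  apply/row_subP => i; set c := row i _.
  have : (c <= <<ev alpha e>> :&: \sum_(e' in L | e' != e) <<ev alpha e'>>)%MS.
    exact: row_sub.
  rewrite sub_capmx genmxE => /andP[/sub_rVP[k cE]].
  have -> : (\sum_(e' in L | e' != e) <<ev alpha e'>>
             = code alpha (L :\ e))%MS.
    by apply: eq_bigl => e'; rewrite !inE andbC.
  case/sub_codeP => a aE a0; rewrite cE.
  suff -> : k = 0 by rewrite scale0r sub0mx.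
  (* A vector of the intersection gives a relation with coefficients [a], diminished by [k] at [e];
     since [a e = 0], the coefficient at [e] is [- k]. *)
  have := @ev_independent (fun e' => a e' - (if e' == e then k else 0)) _ e.
  rewrite eqxx a0 ?inE ?eqxx // sub0r => H; apply: oppr_inj; rewrite oppr0 H //.
  under eq_bigr => e' _ do rewrite scalerBl.
  rewrite sumrB -aE (bigD1 e) //= eqxx cE big1 ?addr0 ?subrr // => e' /negPf ->.
  exact: scale0r.
rewrite /code (mxdirectP dx) /= -sum1_card; apply: eq_bigr => e _.
by rewrite genmxE rank_rV ev_neq0.
Qed.

Lemma code_wt_ge (L : {set {ffun 'I_m -> 'I_s}}) d (c : 'rV[F]_n) :
  (forall e, e \in L -> d <= Dfun e)%N -> (c <= code alpha L)%MS -> c != 0 ->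
  (d <= wt c)%N.
Proof.
move=> dL /sub_codeP[a -> a0] c0.
have [e0 ae0] : exists e, a e != 0.
  apply/existsP; apply: contraNT c0; rewrite negb_exists => /forallP H.
  by rewrite big1 // => e _; have := H e; rewrite negbK => /eqP ->; rewrite scale0r.
have [e ae] := wt_comb_ev ae0; apply: leq_trans; apply: dL.
by apply: contraNT ae => /a0 ->.
Qed.

(** The monomial from [dual_footprint_bound] pairs nontrivially with [c], so it cannot lie in
    [L]. *)
Lemma dual_code_wt_ge (L : {set {ffun 'I_m -> 'I_s}}) d (c : 'rV[F]_n) :
  (forall e, e \notin L -> d <= Dperp e)%N -> (c <= dualC (code alpha L))%MS ->
  c != 0 -> (d <= wt c)%N.
Proof.
move=> dL /sub_kermxP cL c0.
(* The word as a function of points; by injectivity of [alpha] each sum has at most one term. *)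
pose f x := \sum_(j | alpha j == x) c 0 j.
have fE j : c 0 j = f (alpha j).
  by rewrite /f (big_pred1 j) // => i; rewrite /= (inj_eq alpha_inj).
have [j0 cj0] : exists j, c 0 j != 0.
  apply/existsP; apply: contraNT c0; rewrite negb_exists => /forallP H.
  by apply/eqP/rowP => j; have := H j; rewrite negbK mxE => /eqP.
have x0S : alpha j0 \in family S by apply/familyP.
rewrite fE in cj0.
have [e fe De] := dual_footprint_bound cardS x0S cj0.
rewrite (wt_grid fE); apply: leq_trans De; apply: dL.
apply: contraNN fe => /ev_sub_code/submxP[D evD].
have := congr1 (fun A => A *m D^T) cL.
rewrite mul0mx -mulmxA -trmx_mul -evD => /matrixP/(_ 0 0).
rewrite !mxE -(big_grid _ (fun x => f x * monomial_at x e)) => c_ev.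
apply/eqP; rewrite -[RHS]c_ev; apply: eq_bigr => j _; by rewrite mxE evE fE.
Qed.

End Codes.

(** A word outside [C2] is nonzero; [d <= n] takes care of the value [n] at which the minimum in
    [M1] starts. *)
Lemma M1_ge (F : finFieldType) (n d : nat) (C1 C2 : 'M[F]_n) : (d <= n)%N ->
  (forall c : 'rV[F]_n, (c <= C1)%MS -> c != 0 -> (d <= wt c)%N) ->
  (d <= M1 C1 C2)%N.
Proof.
move=> dn H; rewrite /M1; elim/big_ind: _ => // [x y|c /andP[c1 c2]].
  by rewrite leq_min => -> ->.
by apply: H => //; apply: contraNneq c2 => ->; rewrite sub0mx.
Qed.
End GridCodes.

(** * Parameters of the nested pair of codes *)

Theorem mainTheorem4 (F : finFieldType) (m s : nat) (S : 'I_m -> {set F})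
  (alpha : 'I_(s ^ m) -> {ffun 'I_m -> F}) (d v dp : nat) :
  2 <= m -> 2 <= s -> s <= #|F| ->
  (forall i, #|S i| = s) ->
  injective alpha -> (forall j i, alpha j i \in S i) ->
  1 <= d <= s ^ m -> v < m -> s ^ v <= d <= s ^ v.+1 ->
  0 < dp -> dperp_ok s m v d dp ->
  let L1 := [set e : {ffun 'I_m -> 'I_s} | d <= Dfun e] in
  let L2 := [set e : {ffun 'I_m -> 'I_s} | Dperp e < dp] in
  let C1 := code alpha L1 in
  let C2 := code alpha L2 in
  let ell := #|L1| - #|L2| in
  [/\ L2 \subset L1,
      ell = \rank C1 - \rank C2,
      Rge (INR ell) (ell_bound s m d dp) &
      (1 <= ell ->
       [/\ d <= M1 C1 C2,
           dp <= M1 (dualC C2) (dualC C1),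
           dp - 1 <= t1 C1 C2 &
           rl C1 C2 <= s ^ m - d + 1])].
Proof.
move=> m2 s2 _ cardS alpha_inj alphaS /andP[d0 d_le] vm /andP[d_ge _] dp0 dp_ok L1 L2 C1 C2 ell.
have m0 : 0 < m by exact: ltnW.
have s0 : 0 < s by exact: ltnW.
have dp_le := dperp_ok_leq_card s2 vm d_ge dp_ok.
have L21 : L2 \subset L1.
  apply/subsetP => e; rewrite !inE; apply: contraLR; rewrite -ltnNge -leqNgt => De.
  have H1 := dperp_ok_leq s2 vm dp_ok.
  have H2 := Dperp_Dfun_ge e s2 vm.
  have sv : 0 < s ^ v by rewrite expn_gt0 s0.
  (* With [k = m - v - 1], [H1] and [H2] chain to [dp * s ^ v + d * s ^ k <= s ^ v * Dperp e + s ^ k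
     * Dfun e], and [Dfun e < d] leaves [dp <= Dperp e]. *)
  rewrite -(leq_pmul2r sv) -(leq_add2r (d * s ^ (m - v - 1))).
  apply: leq_trans H1 (leq_trans H2 _).
  by rewrite (mulnC (s ^ v)) leq_add2l mulnC leq_mul2r (ltnW De) orbT.
have ell_ge : Rge (INR ell) (ell_bound s m d dp).
  have H1 := card_Dperp_lt_exp_trunc m0 s0 d0 d_le.
  have H2 := card_Dperp_lt_exp_trunc m0 s0 dp0 dp_le.
  rewrite -card_Dfun_lt in H1; rewrite ell_bound_exp_trunc; last exact/ltP.
  have L1E : #|L1| + #|[set e : {ffun 'I_m -> 'I_s} | Dfun e < d]| = s ^ m.
    have <- : ~: L1 = [set e | Dfun e < d] by apply/setP => e; rewrite !inE ltnNge.
    by rewrite cardsC card_ffun !card_ord.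
  (* The inclusion makes the truncated subtraction exact, so that [INR] turns it into a real
     difference. *)
  have L2E : #|L1| - #|L2| + #|L2| = #|L1| by rewrite subnK // subset_leq_card.
  move/(congr1 INR): L1E; move/(congr1 INR): L2E; rewrite -/ell !plus_INR INR_expn.
  by rewrite -/L2 in H2; lra.
have d_M1 : d <= M1 C1 C2.
  apply: M1_ge => // c; apply: code_wt_ge => // e; by rewrite inE.
have dp_M1 : dp <= M1 (dualC C2) (dualC C1).
  apply: M1_ge => // c; apply: dual_code_wt_ge => // e; by rewrite inE -leqNgt.
split=> //; first by rewrite !(rank_code cardS _ alpha_inj alphaS).
move=> _; split=> //; first by rewrite /t1 -subn1 leq_sub2r.
by rewrite /rl addn1 ltnS leq_sub2l.
Qed.
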